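(* Let $0<M<1$. If $\mathcal{L}(S_M)\subset K$, then $M\le\frac{1}{2}$.
   Context: $\mathbb{D}$ is the open unit disk in $\mathbb{C}$, $\mathcal{H}(\mathbb{D})$ is the class of functions analytic in $\mathbb{D}$, and $\mathcal{H}_0(\mathbb{D})$ is the set of $f\in\mathcal{H}(\mathbb{D})$ with $f(0)=0$ and $f'(0)=1$. For $0<M<1$, $$S_M=\left\{f\in\mathcal{H}_0(\mathbb{D}):\ \left|\frac{zf'(z)}{f(z)}-1\right|<M \text{ for all } z\in\mathbb{D}\right\},$$ where $zf'(z)/f(z)$ is understood to be analytic in $\mathbb{D}$ (with value $1$ at $z=0$; in particular $f\neq 0$ on $\mathbb{D}\setminus\{0\}$). $K$ is the class of (univalent) convex functions: those univalent $f\in\mathcal{H}_0(\mathbb{D})$ with $\operatorname{Re}\left\{1+\frac{zf''(z)}{f'(z)}\right\}>0$ for all $z\in\mathbb{D}$. The Libera transform of $f\in\mathcal{H}_0(\mathbb{D})$ is $\mathcal{L}(f)(z)=\frac{2}{z}\int_0^z f(\zeta)\,d\zeta$, extended analytically to $z=0$ with value $0$. *)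

(* Defs.v *)
From Stdlib Require Import Reals.
From Coquelicot Require Import Coquelicot.

Open Scope C_scope.

(* Functions on the unit disk are represented by total functions [C -> C];
   only their values on [disk] matter in what follows. *)
Definition disk (z : C) : Prop := (Cmod z < 1)%R.

(* "Analytic in the disk" is complex differentiability at each of its points:
   the field of scalars of [ex_derive] is [C_AbsRing], not [R_AbsRing]. *)
Definition analytic_on_disk (f : C -> C) : Prop :=
  forall z : C, disk z -> @ex_derive C_AbsRing C_NormedModule f z.

Definition H0_class (f : C -> C) : Prop :=
  analytic_on_disk f /\ f 0 = 0 /\ C_derive f 0 = 1.

(* z f'(z) / f(z), with its removable singularity at 0 filled in. *)
Definition zf'_over_f (f : C -> C) (z : C) : C :=
  if Ceq_dec z 0 then 1 else z * C_derive f z / f z.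

(* The clause [f z <> 0] is what makes z f'(z) / f(z) analytic in the disk;
   it also excludes the conventional value of a division by zero. *)
Definition S_class (M : R) (f : C -> C) : Prop :=
  H0_class f /\
  (forall z : C, disk z -> z <> 0 -> f z <> 0) /\
  (forall z : C, disk z -> (Cmod (zf'_over_f f z - 1) < M)%R).

Definition univalent_on_disk (f : C -> C) : Prop :=
  analytic_on_disk f /\
  forall z w : C, disk z -> disk w -> f z = f w -> z = w.

(* No separate clause f'(z) <> 0 is needed for the quotient to be meaningful:
   the derivative of a univalent function has no zero. *)
Definition K_class (f : C -> C) : Prop :=
  H0_class f /\ univalent_on_disk f /\
  forall z : C, disk z ->
    (0 < Re (1 + z * C_derive (C_derive f) z / C_derive f z))%R.

(* The contour integral of f from 0 to z along the segment t |-> t z,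
   0 <= t <= 1; for f analytic in the disk it does not depend on the path. *)
Definition integral_from_0 (f : C -> C) (z : C) : C :=
  @RInt C_R_CompleteNormedModule (fun t : R => f (RtoC t * z) * z) 0%R 1%R.

Definition Libera (f : C -> C) (z : C) : C :=
  if Ceq_dec z 0 then 0 else 2 / z * integral_from_0 f z.

(* Main.v *)
Require Import Defs.
From Stdlib Require Import Reals Lra Lia.
From Coquelicot Require Import Coquelicot.
Local Open Scope C_scope.

(** The functions f(z) = z + a z^(n+1) with a = M / (n + M) belong to S_M, and
    L(f)(z) = z + b z^(n+1) with b = 2a / (n + 2).  For n odd and z real tending
    to -1, the convexity quotient of L(f) tends to
    (1 - (n+1)^2 b) / (1 - (n+1) b), whose denominator is positive; so convexity
    forces (n+1)^2 b <= 1, that is, 2M (n+1)^2 <= (n+M)(n+2).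
    As n tends to infinity this gives 2M <= 1. *)

(** * Complex derivatives of z + b z^(n+1) *)

Definition Cbinom (b : R) (n : nat) (z : C) : C := z + b * z ^ S n.

(* The two normed modules carry different uniform structures (product balls
   against balls for [Cmod]) but the same norm. *)
Lemma is_derive_C_AbsRing (f : C -> C) (z l : C) :
  @is_derive C_AbsRing (AbsRing_NormedModule C_AbsRing) f z l <->
  @is_derive C_AbsRing C_NormedModule f z l.
Proof.
  split; intros [[Hp Hs Hn] Hd];
    (split; [constructor; [exact Hp|exact Hs|exact Hn]|exact Hd]).
Qed.

Lemma is_derive_Cid (z : C) :
  @is_derive C_AbsRing C_NormedModule (fun w : C => w) z (RtoC 1).
Proof.
  apply is_derive_C_AbsRing, (@is_derive_id C_AbsRing).
Qed.

Lemma is_derive_Cpow (n : nat) (z : C) :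
  @is_derive C_AbsRing C_NormedModule (fun w : C => w ^ S n) z (INR (S n) * z ^ n).
Proof.
  induction n as [|n IH].
  - apply (is_derive_ext (fun w : C => w)).
    + intros t; symmetry; apply Cpow_1_r.
    + replace (INR 1 * z ^ 0) with (RtoC 1) by (simpl; ring).
      apply is_derive_Cid.
  - apply (is_derive_ext (fun w : C => w * w ^ S n)).
    + intros t; reflexivity.
    + replace (INR (S (S n)) * z ^ S n)
        with (plus (mult (RtoC 1) (z ^ S n)) (mult z (INR (S n) * z ^ n))).
      * apply is_derive_C_AbsRing, (@is_derive_mult C_AbsRing (fun w : C => w) (fun w : C => w ^ S n)).
        -- apply (@is_derive_id C_AbsRing).
        -- apply is_derive_C_AbsRing, IH.
        -- exact Cmult_comm.
      * change (1 * z ^ S n + z * (INR (S n) * z ^ n) = INR (S (S n)) * z ^ S n).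
        rewrite (S_INR (S n)), RtoC_plus, Cpow_S; ring.
Qed.

(** This shape covers both [Cbinom] and its first derivative, so one computation yields the first
    and the second derivative. *)
Lemma is_derive_affine_Cpow (u v c : C) (n : nat) (z : C) :
  @is_derive C_AbsRing C_NormedModule (fun w : C => u + v * w + c * w ^ S n) z
    (v + c * INR (S n) * z ^ n).
Proof.
  apply (is_derive_ext
    (fun w : C => plus (plus u (scal w v)) (scal (w ^ S n) c))).
  - intros w.
    change (u + w * v + w ^ S n * c = u + v * w + c * w ^ S n); ring.
  - replace (v + c * INR (S n) * z ^ n)
      with (plus (plus zero (scal (RtoC 1) v)) (scal (INR (S n) * z ^ n) c)).
    + apply @is_derive_plus; [apply @is_derive_plus|].
      * apply @is_derive_const.
      * apply (@is_derive_scal_l C_AbsRing C_NormedModule (fun w : C => w)).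
        apply is_derive_C_AbsRing, is_derive_Cid.
      * apply (@is_derive_scal_l C_AbsRing C_NormedModule (fun w : C => w ^ S n)).
        apply is_derive_C_AbsRing, is_derive_Cpow.
    + change (0 + 1 * v + INR (S n) * z ^ n * c = v + c * INR (S n) * z ^ n); ring.
Qed.

Lemma is_derive_Cbinom (b : R) (n : nat) (z : C) :
  @is_derive C_AbsRing C_NormedModule (Cbinom b n) z (1 + b * INR (S n) * z ^ n).
Proof.
  apply (is_derive_ext (fun w : C => 0 + 1 * w + b * w ^ S n)).
  - intros w; unfold Cbinom; change (0 + 1 * w + b * w ^ S n = w + b * w ^ S n); ring.
  - apply is_derive_affine_Cpow.
Qed.

Lemma C_derive_Cbinom (b : R) (n : nat) (z : C) :
  C_derive (Cbinom b n) z = 1 + b * INR (S n) * z ^ n.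
Proof. apply is_C_derive_unique, is_derive_Cbinom. Qed.

Lemma C_derive2_Cbinom (b : R) (n : nat) (z : C) :
  C_derive (C_derive (Cbinom b (S n))) z = b * INR (S (S n)) * INR (S n) * z ^ n.
Proof.
  apply is_C_derive_unique.
  apply (is_derive_ext (fun w : C => 1 + 0 * w + b * INR (S (S n)) * w ^ S n)).
  - intros w; rewrite C_derive_Cbinom.
    change (1 + 0 * w + b * INR (S (S n)) * w ^ S n = 1 + b * INR (S (S n)) * w ^ S n); ring.
  - replace (b * INR (S (S n)) * INR (S n) * z ^ n)
      with (0 + b * INR (S (S n)) * INR (S n) * z ^ n) by ring.
    apply is_derive_affine_Cpow.
Qed.

(** * The Libera transform of z + a z^(n+1) *)

Lemma is_RInt_pow_scal (n : nat) (c : C) :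
  @is_RInt C_R_NormedModule (fun t : R => (t ^ n)%R * c) 0%R 1%R
    ((/ INR (S n))%R * c).
Proof.
  assert (Hn : INR (S n) <> 0%R) by (apply not_0_INR; lia).
  replace ((/ INR (S n))%R * c)
    with (@minus C_R_NormedModule (scal (1 ^ S n / INR (S n))%R c)
                 (scal (0 ^ S n / INR (S n))%R c)).
  - apply (is_RInt_ext (V := C_R_NormedModule)
      (fun t : R => @scal _ C_R_NormedModule (t ^ n)%R c)).
    + intros t _; apply scal_R_Cmult.
    + apply (@is_RInt_derive C_R_CompleteNormedModule
        (fun t : R => @scal _ C_R_NormedModule (t ^ S n / INR (S n))%R c)).
      * intros t _.
        apply (@is_derive_scal_l R_AbsRing C_R_NormedModule
          (fun t : R => (t ^ S n / INR (S n))%R)).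
        auto_derive; [trivial|]; simpl pred; field; exact Hn.
      * intros t _.
        apply (@continuous_scal_l _ R_AbsRing C_R_NormedModule (fun t : R => (t ^ n)%R)).
        apply (ex_derive_continuous (V := R_NormedModule)); auto_derive; trivial.
  - rewrite !scal_R_Cmult, pow1, pow_i by lia.
    change (RtoC (1 / INR (S n)) * c - RtoC (0 / INR (S n)) * c = (/ INR (S n))%R * c).
    unfold Rdiv; rewrite Rmult_0_l, Rmult_1_l; ring.
Qed.

(** Along the segment the integrand is t z^2 + a t^(n+1) z^(n+2), with integral z^2/2 + a
    z^(n+2)/(n+2); the factor 2/z does the rest. *)
Lemma Libera_Cbinom (a : R) (n : nat) (z : C) :
  Libera (Cbinom a n) z = Cbinom (2 * a / (INR n + 2)) n z.
Proof.
  assert (Hn : (0 <= INR n)%R) by apply pos_INR.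
  unfold Libera; destruct (Ceq_dec z 0) as [->|Hz].
  - unfold Cbinom; rewrite Cpow_S; ring.
  - unfold integral_from_0.
    rewrite (@is_RInt_unique C_R_CompleteNormedModule _ _ _
      ((/ INR 2)%R * (z * z) + (/ INR (S (S n)))%R * (a * z ^ S n * z))).
    + rewrite !S_INR; simpl INR; unfold Cbinom.
      replace (0 + 1 + 1)%R with 2%R by ring.
      replace (INR n + 1 + 1)%R with (INR n + 2)%R by ring.
      unfold Rdiv; rewrite !RtoC_mult, !RtoC_inv, RtoC_plus by lra.
      rewrite Cpow_S; field.
      split; [|exact Hz].
      change (INR n + 2 <> 0); rewrite <- RtoC_plus; intros H; apply RtoC_inj in H; lra.
    + apply (is_RInt_ext (V := C_R_NormedModule)
        (fun t : R => plus ((t ^ 1)%R * (z * z)) ((t ^ S n)%R * (a * z ^ S n * z)))).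
      * intros t _; unfold Cbinom; rewrite Cpow_mult_l, !RtoC_pow.
        change (t ^ 1 * (z * z) + t ^ S n * (a * z ^ S n * z)
          = (t * z + a * (t ^ S n * z ^ S n)) * z).
        rewrite Cpow_1_r; ring.
      * apply @is_RInt_plus; apply is_RInt_pow_scal.
Qed.

(** * Membership in S_M *)

Lemma Cbinom_H0_class (b : R) (n : nat) : H0_class (Cbinom b (S n)).
Proof.
  split; [|split].
  - intros z _; eexists; apply is_derive_Cbinom.
  - unfold Cbinom; rewrite Cpow_S; ring.
  - rewrite C_derive_Cbinom, Cpow_S; ring.
Qed.

Lemma pow_lt_1 (x : R) (n : nat) : (0 <= x < 1 -> x ^ S n < 1)%R.
Proof.
  intros Hx; induction n as [|n IH]; simpl in *; [lra|].
  assert (0 <= x ^ n)%R by (apply pow_le; lra); nra.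
Qed.

(** With N = n + 1, z f'/f - 1 = a N z^N / (1 + a z^N), of modulus at most a N r / (1 - a r) for r =
    |z^N| < 1. The value of a makes this bound equal to M at r = 1. *)
Lemma Cbinom_S_class (M : R) (n : nat) :
  (0 < M < 1)%R -> S_class M (Cbinom (M / (INR (S n) + M)) (S n)).
Proof.
  intros HM.
  assert (Hn : (0 < INR (S n))%R) by (apply lt_0_INR; lia).
  set (a := (M / (INR (S n) + M))%R).
  assert (Ha : (a * (INR (S n) + M) = M)%R) by (unfold a; field; lra).
  assert (Ha0 : (0 < a)%R) by (unfold a; apply Rdiv_lt_0_compat; lra).
  assert (Ha1 : (a < 1)%R) by nra.
  assert (Hr : forall z, disk z -> (0 <= Cmod (z ^ S n) < 1)%R).
  { intros z Hz; split; [apply Cmod_ge_0|].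
    rewrite Cmod_pow; apply pow_lt_1; split; [apply Cmod_ge_0|exact Hz]. }
  assert (Hd : forall z, (1 - a * Cmod (z ^ S n) <= Cmod (1 + a * z ^ S n))%R).
  { intros z.
    assert (H := Cmod_triangle (1 + a * z ^ S n) (- (a * z ^ S n))).
    replace (1 + a * z ^ S n + - (a * z ^ S n)) with (RtoC 1) in H by ring.
    rewrite Cmod_1, Cmod_opp, Cmod_mult, Cmod_R, Rabs_pos_eq in H; lra. }
  assert (Hnz : forall z, disk z -> 1 + a * z ^ S n <> 0).
  { intros z Hz H; specialize (Hr z Hz); specialize (Hd z).
    rewrite H, Cmod_0 in Hd; nra. }
  assert (Hf : forall z, Cbinom a (S n) z = z * (1 + a * z ^ S n)).
  { intros z; unfold Cbinom; rewrite (Cpow_S z (S n)); ring. }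
  split; [apply Cbinom_H0_class|split].
  - intros z Hz Hz0; rewrite Hf; apply Cmult_neq_0; auto.
  - intros z Hz; unfold zf'_over_f; destruct (Ceq_dec z 0) as [_|Hz0].
    + replace (1 - 1) with (RtoC 0) by ring; rewrite Cmod_0; lra.
    + rewrite Hf, C_derive_Cbinom, (S_INR (S n)), RtoC_plus.
      specialize (Hnz z Hz); specialize (Hr z Hz); specialize (Hd z).
      replace (_ - 1) with (a * INR (S n) * z ^ S n / (1 + a * z ^ S n))
        by (field; split; assumption).
      rewrite Cmod_div, !Cmod_mult, !Cmod_R, !Rabs_pos_eq by (assumption || lra).
      set (r := Cmod (z ^ S n)) in *.
      (* Once the denominator is cleared, M (1 - a r) - a N r = M (1 - r) > 0, because a N = M (1 -
         a). *)
      apply Rmult_lt_reg_r with (Cmod (1 + a * z ^ S n)); [nra|].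
      unfold Rdiv; rewrite Rmult_assoc, Rinv_l by nra.
      nra.
Qed.

(** * Convexity tested on the negative real axis *)

Lemma Re_convexity_quotient_Cbinom (b x : R) (n : nat) :
  (1 + b * INR (S (S n)) * x ^ S n)%R <> 0%R ->
  Re (1 + x * C_derive (C_derive (Cbinom b (S n))) x / C_derive (Cbinom b (S n)) x)
  = ((1 + b * INR (S (S n)) ^ 2 * x ^ S n) / (1 + b * INR (S (S n)) * x ^ S n))%R.
Proof.
  intros H.
  rewrite C_derive2_Cbinom, C_derive_Cbinom, <- !RtoC_pow.
  rewrite <- !RtoC_mult, <- !RtoC_plus, <- RtoC_div, <- RtoC_plus, re_RtoC by exact H.
  (* With m = n + 2, the terms b m x^(n+1) and b m (n+1) x^(n+1) of the numerator add up to b m^2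
     x^(n+1). *)
  change (x ^ S n)%R with (x * x ^ n)%R in *; rewrite (S_INR (S n)) in *.
  field; exact H.
Qed.

Lemma odd_root_opp (k : nat) (s : R) :
  (0 < s < 1)%R -> exists x : R, (-1 < x < 0)%R /\ (x ^ S (2 * k) = - s)%R.
Proof.
  intros Hs.
  assert (Hn : (0 < INR (S (2 * k)))%R) by (apply lt_0_INR; lia).
  set (r := Rpower s (/ INR (S (2 * k)))).
  assert (Hr0 : (0 < r)%R) by apply exp_pos.
  assert (Hr : (r ^ S (2 * k) = s)%R).
  { rewrite <- Rpower_pow by exact Hr0.
    unfold r; rewrite Rpower_mult, Rinv_l by lra; apply Rpower_1; lra. }
  exists (- r)%R; split.
  - split; [|lra].
    destruct (Rlt_or_le r 1) as [|H]; [lra|].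
    assert (1 <= r ^ S (2 * k))%R by (apply pow_R1_Rle; exact H); lra.
  - replace (- r)%R with (-1 * r)%R by ring.
    rewrite Rpow_mult_distr, pow_1_odd, Hr; ring.
Qed.

(** Let m = 2k + 2 and c = b m^2. At a point x where x^(2k+1) = -s', the quotient is (1 - c s') / (1
    - b m s'). If c > 1, some s' < 1 makes the numerator negative, while b m <= 1 keeps the
    denominator positive. *)
Lemma Cbinom_K_class_odd (b : R) (k : nat) :
  (0 <= b * INR (2 * k + 2) <= 1)%R -> K_class (Cbinom b (S (2 * k))) ->
  (b * INR (2 * k + 2) ^ 2 <= 1)%R.
Proof.
  intros Hb [_ [_ HK]].
  replace (2 * k + 2)%nat with (S (S (2 * k))) in * by lia.
  destruct (Rle_or_lt (b * INR (S (S (2 * k))) ^ 2) 1) as [|Hc]; [assumption|exfalso].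
  set (c := (b * INR (S (S (2 * k))) ^ 2)%R) in *.
  set (s := (/ c)%R).
  assert (Hs : (0 < s)%R) by (apply Rinv_0_lt_compat; lra).
  assert (Hcs : (c * s = 1)%R) by (unfold s; field; lra).
  assert (Hs1 : (s < 1)%R) by nra.
  (* The midpoint of 1/c and 1, so that c s' > 1 and s' < 1. *)
  set (s' := ((1 + s) / 2)%R).
  destruct (odd_root_opp k s') as [x [Hx Hxs]]; [unfold s'; lra|].
  assert (Hden : (0 < 1 + b * INR (S (S (2 * k))) * x ^ S (2 * k))%R).
  { rewrite Hxs; unfold s'; nra. }
  specialize (HK x).
  rewrite Re_convexity_quotient_Cbinom in HK by lra.
  fold c in HK.
  assert (Hdisk : disk x) by (unfold disk; rewrite Cmod_R; apply Rabs_def1; lra).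
  specialize (HK Hdisk).
  assert (Hnum : (1 + c * x ^ S (2 * k) < 0)%R) by (rewrite Hxs; unfold s'; nra).
  assert (Hinv := Rinv_0_lt_compat _ Hden).
  unfold Rdiv in HK; nra.
Qed.

Theorem theorem4p2 :
  forall M : R, (0 < M < 1)%R ->
    (forall f : C -> C, S_class M f -> K_class (Libera f)) ->
    (M <= 1 / 2)%R.
Proof.
  intros M HM HL.
  destruct (Rle_or_lt M (1 / 2)) as [|HM2]; [assumption|exfalso].
  (* The choice 1/k < 2M - 1 makes the exponent 2k + 2 large enough to violate the necessary
     inequality. *)
  destruct (archimed_cor1 (2 * M - 1)) as [k [Hk Hk0]]; [lra|].
  assert (Hkp : (1 <= INR k)%R) by (change 1%R with (INR 1); apply le_INR; lia).
  assert (Hkd : (1 < INR k * (2 * M - 1))%R).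
  { apply Rmult_lt_compat_l with (r := INR k) in Hk; [|lra].
    rewrite Rinv_r in Hk; lra. }
  specialize (HL _ (Cbinom_S_class M (2 * k) HM)).
  assert (HF : Libera (Cbinom (M / (INR (S (2 * k)) + M)) (S (2 * k)))
    = Cbinom (2 * (M / (INR (S (2 * k)) + M)) / (INR (S (2 * k)) + 2)) (S (2 * k))).
  (* The formula for the transform holds at every z, inside the disk or not, so the total functions
     are equal. *)
  { apply FunctionalExtensionality.functional_extensionality; intros z.
    apply Libera_Cbinom. }
  rewrite HF in HL; clear HF.
  apply Cbinom_K_class_odd in HL;
    rewrite ?S_INR, ?plus_INR, mult_INR in *; simpl (INR 2) in *.
  - set (x := INR k) in *.
    assert (Hd : (0 < (2 * x + 1 + M) * (2 * x + 1 + 2))%R) by nra.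
    apply Rmult_le_compat_r with (r := ((2 * x + 1 + M) * (2 * x + 1 + 2))%R) in HL; [|lra].
    replace (_ * _)%R with (2 * M * (2 * x + 2) ^ 2)%R in HL by (simpl; field; lra).
    (* [HL] amounts to 4 (2M - 1)(k + 1)^2 <= M (2k + 3) - 1. The left side exceeds 4 (k + 1), since
       (2M - 1) k > 1, and the right side is below 2k + 2, since M < 1. *)
    nra.
  (* It remains to bound b (2k + 2) by 0 and 1: since M < 1 <= k, 2M (2k + 2) < 4k + 4 <= (2k +
     1)(2k + 3). *)
  - set (x := INR k) in *.
    assert (Hd : (0 < (2 * x + 1 + M) * (2 * x + 1 + 2))%R) by nra.
    replace (_ * _)%R with (2 * M * (2 * x + 2) / ((2 * x + 1 + M) * (2 * x + 1 + 2)))%R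
      by (field; lra).
    split.
    + apply Rdiv_le_0_compat; nra.
    + apply Rle_div_l; nra.
Qed.
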